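(* Let $q\ge1$, $p=q-1$, and let $A=(a_1,\ldots,a_p)$, $B=(b_1,\ldots,b_q)$ be vectors of positive real numbers. Suppose that the number $$d=\min_{i\in\{1,2,\ldots,q\}}\left[\frac{e_i(b_1,\ldots,b_q)-e_i(a_1,\ldots,a_p)}{e_{i-1}(a_1,\ldots,a_p)}\right],$$ where $e_0=1$ and $e_q(a_1,\ldots,a_p)=0$, is positive. Then for all $x\ge0$ $${}_{q-1}F_q(A;B;x)\le e^{\sqrt{4x+(d+1)^2}-d-1}\left(\frac{d-1}{2d}+\frac{1}{2d}\sqrt{4x+(d+1)^2}\right)^{1-d}.$$
   Context: ${}_pF_q(A;B;x)=\sum_{n\ge 0}\frac{(a_1)_n\cdots(a_p)_n}{(b_1)_n\cdots(b_q)_n\,n!}x^n$, where $(a)_0=1$, $(a)_n=a(a+1)\cdots(a+n-1)$; empty products equal $1$. The elementary symmetric polynomials are $e_0=1$, $e_k(x_1,\ldots,x_m)=\sum_{1\le j_1<\cdots<j_k\le m}x_{j_1}\cdots x_{j_k}$ for $1\le k\le m$, and $e_k(x_1,\ldots,x_m)=0$ for $k>m$. *)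

(* Defs.v *)
From HB Require Import structures.
From mathcomp Require Import all_boot all_order all_algebra.
From mathcomp Require mpoly.

Set Implicit Arguments.
Unset Strict Implicit.
Unset Printing Implicit Defensive.

Import Order.TTheory GRing.Theory Num.Theory.
Local Open Scope ring_scope.

(* [mesym n R k] is 1 for k = 0 and 0 for k > n. *)
Definition elem_sym (R : comNzRingType) (n : nat) (v : 'I_n -> R) (k : nat) : R :=
  mpoly.meval v (mpoly.mesym n R k).

(* mpoly's notations clash with those of mathcomp-analysis, so mpoly is only
   imported inside this module. *)
Module ElemSym.
Import mpoly.

Lemma elem_symE (R : comNzRingType) (n : nat) (v : 'I_n -> R) (k : nat) :
  elem_sym v k = \sum_(J : {set 'I_n} | #|J| == k) \prod_(j in J) v j.
Proof.
rewrite /elem_sym /mesym raddf_sum /=; apply: eq_bigr => J _.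
by rewrite rmorph_prod; apply: eq_bigr => j _; apply: mevalXU.
Qed.

End ElemSym.

Definition elem_symE := ElemSym.elem_symE.

From mathcomp Require Import all_classical all_reals all_analysis.
Import numFieldNormedType.Exports.

Definition pochhammer (R : nzRingType) (a : R) (n : nat) : R :=
  \prod_(0 <= k < n) (a + k%:R).

Definition hypergeom_coeff (R : fieldType) (p q : nat)
    (a : 'I_p -> R) (b : 'I_q -> R) (n : nat) : R :=
  (\prod_(i < p) pochhammer (a i) n) /
  ((\prod_(j < q) pochhammer (b j) n) * n`!%:R).

(* pFq(a; b; x), the sum of the series.  [limn] is total, and the value is only
   meaningful where the series converges; for p <= q and positive b this is the
   case for every x. *)
Definition hypergeom (R : realType) (p q : nat)
    (a : 'I_p -> R) (b : 'I_q -> R) (x : R) : R :=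
  limn (pseries (hypergeom_coeff a b) x).

Definition elem_sym_ratio (R : fieldType) (p q : nat)
    (a : 'I_p -> R) (b : 'I_q -> R) (i : nat) : R :=
  (elem_sym b i - elem_sym a i) / elem_sym a i.-1.

(* The minimum over 1 <= i <= q; since q >= 1 in all uses, the initial value
   [elem_sym_ratio a b 1] of the iterated minimum is one of the terms. *)
Definition min_elem_sym_ratio (R : realType) (p q : nat)
    (a : 'I_p -> R) (b : 'I_q -> R) : R :=
  \big[Num.min/elem_sym_ratio a b 1]_(1 <= i < q.+1) elem_sym_ratio a b i.

(* Main.v *)
(* Expanding products gives [prod_j (b_j + n) >= (n + d) prod_i (a_i + n)], so the
   coefficients satisfy [(n + 1)(n + d) c_(n+1) <= c_n] and every partial sum
   [P_(n+1)] satisfies [x P_(n+1)'' + d P_(n+1)' <= P_n] on [x >= 0].  The right-hand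
   side [G] of the bound satisfies [x G'' + d G' >= G] and [G 0 = 1], which gives
   [P_n <= G] by induction on [n]. *)
Require Import Defs.
From mathcomp Require Import all_boot all_order all_algebra.
From mathcomp Require Import all_classical all_reals all_analysis.
From mathcomp Require Import ring lra.

Import Order.TTheory GRing.Theory Num.Theory.
Import numFieldNormedType.Exports.
Local Open Scope ring_scope.

(** * Elementary symmetric polynomials and the product inequality *)

Lemma prod_addr_elem_sym (R : comNzRingType) (n : nat) (v : 'I_n -> R) (x : R) :
  \prod_(i < n) (v i + x) = \sum_(k < n.+1) elem_sym v k * x ^+ (n - k).
Proof.
rewrite bigA_distr.
(* Expanding the product gives one term per set [J] of indices at which [v i] is picked; these sets
   are grouped by cardinality, which is at most [n], so [inord] loses nothing. *)
rewrite (partition_big (fun J : {set 'I_n} => inord #|J| : 'I_n.+1) predT) //=.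
apply: eq_bigr => k _; rewrite elem_symE big_distrl /=.
have cardJ (J : {set 'I_n}) : (#|J| < n.+1)%N.
  by rewrite ltnS -[n in (_ <= n)%N]card_ord max_card.
apply: eq_big => [J|J /eqP <-].
  by rewrite -val_eqE /= inordK.
rewrite (bigID (mem J)) /=; congr (_ * _).
  by apply: eq_bigr => i ->.
under eq_bigr => i /negbTE -> do [].
rewrite prodr_const inordK //; congr (_ ^+ _).
by rewrite -[X in (X - _)%N]card_ord -(cardC (mem J)) addKn; apply: eq_card.
Qed.

Lemma elem_sym_oversize (R : comNzRingType) (n : nat) (v : 'I_n -> R) (k : nat) :
  (n < k)%N -> elem_sym v k = 0.
Proof.
move=> nk; rewrite elem_symE big_pred0// => J; apply/negbTE.
by rewrite neq_ltn (leq_ltn_trans _ nk)// -[n in (_ <= n)%N]card_ord max_card.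
Qed.

Lemma elem_sym0 (R : comNzRingType) (n : nat) (v : 'I_n -> R) : elem_sym v 0 = 1.
Proof.
rewrite elem_symE (eq_bigl (pred1 finset.set0)); last by move=> J; exact: cards_eq0.
by rewrite big_pred1_eq big_set0.
Qed.

(** Some subset of size [k] exists because [k <= n], and its product is positive. This allows the
    denominators in the ratios defining the minimum to be cleared. *)
Lemma elem_sym_gt0 (R : numDomainType) (n : nat) (v : 'I_n -> R) (k : nat) :
  (forall i, 0 < v i) -> (k <= n)%N -> 0 < elem_sym v k.
Proof.
move=> v0 kn; rewrite elem_symE.
have : (0 < #|[set J : {set 'I_n} | #|J| == k]%SET|)%N.
  by rewrite card_draws card_ord bin_gt0.
case/card_gt0P => J; rewrite inE => Jk.
rewrite (bigD1 J) //= ltr_pwDl ?prodr_gt0 //.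
by apply: sumr_ge0 => K _; apply: prodr_ge0 => i _; exact: ltW.
Qed.

Lemma min_elem_sym_ratio_le (R : realType) (p q : nat)
    (a : 'I_p -> R) (b : 'I_q -> R) (i : nat) :
  (0 < i <= q)%N -> min_elem_sym_ratio a b <= elem_sym_ratio a b i.
Proof. by move=> iq; apply: ge_bigmin_seq; rewrite ?mem_index_iota. Qed.

(** Compare coefficients in powers of [x]. Both sides have leading term [x ^+ p.+1]; at
    [x ^+ (p - k)] the claim is [e_(k+1)(a) + d e_k(a) <= e_(k+1)(b)], which is what the minimum [d]
    guarantees. *)
Lemma prod_addr_le (R : realType) (p : nat)
    (a : 'I_p -> R) (b : 'I_p.+1 -> R) (x : R) :
  (forall i, 0 < a i) -> 0 <= x ->
  (x + min_elem_sym_ratio a b) * \prod_(i < p) (a i + x) <=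
  \prod_(j < p.+1) (b j + x).
Proof.
move=> a0 x0; set d := min_elem_sym_ratio a b.
have le_d (i : 'I_p.+1) :
    elem_sym a i.+1 + d * elem_sym a i <= elem_sym b i.+1.
  rewrite -lerBrDl -ler_pdivlMr; last by apply: elem_sym_gt0; rewrite // -ltnS.
  exact: (@min_elem_sym_ratio_le _ _ _ a b i.+1 (ltn_ord i)).
rewrite !prod_addr_elem_sym [leRHS]big_ord_recl /= !elem_sym0 mul1r subn0 mulrDl.
have -> : x * \sum_(k < p.+1) elem_sym a k * x ^+ (p - k) =
    x ^+ p.+1 + \sum_(k < p.+1) elem_sym a k.+1 * x ^+ (p - k).
  (* The last summand contains [e_(p+1)(a)], which is 0 for only [p] variables. *)
  rewrite [X in _ + X]big_ord_recr/= elem_sym_oversize// mul0r addr0.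
  rewrite big_ord_recl /= elem_sym0 subn0 mul1r mulrDr -exprS; congr (_ + _).
  rewrite big_distrr/=; apply: eq_bigr => k _.
  by rewrite mulrCA -exprS /bump/= add1n subnSK.
rewrite -addrA lerD2l big_distrr -big_split /=; apply: ler_sum => k _.
rewrite /bump/= add1n subSS mulrA -mulrDl.
by rewrite ler_wpM2r ?exprn_ge0.
Qed.

(** * Differential inequalities on the half-line *)

Lemma le_at0_of_derive_ge0 (R : realType) (f f' : R -> R) (x : R) :
  (forall y : R, 0 <= y -> is_derive y 1 f (f' y)) ->
  (forall y : R, 0 <= y -> 0 <= f' y) -> 0 <= x -> f 0 <= f x.
Proof.
move=> df f'0; rewrite le_eqVlt => /predU1P[<-//|x0].
have [||c] := MVT x0 (f := f) (df := f').
- by move=> y /[!in_itv]/= /andP[/ltW y0 _]; exact: df.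
- by apply: derivable_within_continuous => y /[!in_itv]/= /andP[y0 _]; have [] := df y y0.
rewrite in_itv/= => /andP[/ltW c0 _] e.
by rewrite -subr_ge0 e mulr_ge0 ?f'0// subr0 ltW.
Qed.

(* [x g' + d g = x^(1-d) (x^d g)'], so [x^d g] is nondecreasing; if [g x < 0]
   then [g <= g x] on ]0, x[, hence at 0 by continuity. *)
Lemma euler_operator_ge0 (R : realType) (d : R) (g g' : R -> R) (x : R) :
  0 < d -> (forall y : R, 0 <= y -> is_derive y 1 g (g' y)) ->
  (forall y : R, 0 <= y -> 0 <= y * g' y + d * g y) -> 0 <= x -> 0 <= g x.
Proof.
move=> d0 dg eg x0; rewrite leNgt; apply/negP => gx0.
have g00 : 0 <= g 0.
  by have := eg 0 (lexx _); rewrite mul0r add0r pmulr_rge0.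
have {}x0 : 0 < x.
  by rewrite lt_def x0 andbT; apply: contraTneq gx0 => ->; rewrite -leNgt.
suff : g 0 <= g x by lra.
have g_le (e : R) : 0 < e -> e < x -> g e <= g x.
  move=> e0 ex; set h := fun y : R => y `^ d * g y.
  pose h' y := y `^ (d - 1) * (y * g' y + d * g y).
  have dh (y : R) : 0 < y -> is_derive y 1 h (h' y).
    move=> y0; have dp := is_derive1_powR d y0.
    have dgy := dg y (ltW y0); apply: is_derive_eq.
    have yd : y * y `^ (d - 1) = y `^ d by rewrite mulr_powRB1 ?ltW.
    by rewrite /h' /GRing.scale/= -yd; ring.
  have [||c] := MVT ex (f := h) (df := h').
  - move=> y /[!in_itv]/= /andP[ey _]; apply: dh; exact: lt_trans ey.
  - apply: derivable_within_continuous => y /[!in_itv]/= /andP[ey _].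
    by have [] := dh y (lt_le_trans e0 ey).
  rewrite in_itv/= => /andP[ec _] hE.
  have c0 : 0 < c by exact: lt_trans ec.
  have hle : h e <= h x.
    rewrite -subr_ge0 hE !mulr_ge0 ?powR_ge0 ?eg ?(ltW c0)//.
    by rewrite subr_ge0 ltW.
  have ed0 : 0 < e `^ d by exact: powR_gt0.
  rewrite -(ler_pM2l ed0); apply: le_trans hle _.
  (* Since [g x < 0], replacing [x]^ d[by the smaller]e [^ d] increases the product. *)
  by rewrite ler_wnM2r ?ltW//; rewrite gt0_ltr_powR ?nnegrE ?ltW.
have g_cvg : (g y @[y --> (0 : R)^'+] --> g 0)%classic.
  have [dg0 _] := dg 0 (lexx _).
  by apply: cvg_at_right_filter; exact/differentiable_continuous/derivable1_diffP.
apply: (cvgr_to_le g_cvg).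
near=> y; apply: g_le; first by near: y; exact: nbhs_right_gt.
by near: y; exact: nbhs_right_lt.
Unshelve. all: by end_near. Qed.

Lemma horner_ge0 (R : numDomainType) (p : {poly R}) (x : R) :
  (forall i, 0 <= p`_i) -> 0 <= x -> 0 <= p.[x].
Proof.
by move=> p0 x0; rewrite horner_coef sumr_ge0// => i _; rewrite mulr_ge0 ?exprn_ge0.
Qed.

(* If the bound on [c n.+1] is an equality, the partial sums of [sum c n x^n] are
   the Picard iterates of [x y'' + d y' = y], and the supersolution [G] stays above
   each of them. *)
Lemma poly_le_supersolution (R : realType) (c : nat -> R) (d : R)
    (G G' G'' : R -> R) (n : nat) (x : R) :
  0 < d ->
  (forall n, c n.+1 * (n.+1%:R * (n%:R + d)) <= c n) -> c 0%N <= G 0 ->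
  (forall y : R, 0 <= y -> 0 <= G y) ->
  (forall y : R, 0 <= y -> is_derive y 1 G (G' y)) ->
  (forall y : R, 0 <= y -> is_derive y 1 G' (G'' y)) ->
  (forall y : R, 0 <= y -> G y <= y * G'' y + d * G' y) ->
  0 <= x -> (\poly_(i < n) c i).[x] <= G x.
Proof.
move=> d0 cS cG0 G0 dG dG' ode.
elim: n x => [|n IHn] x x0; first by rewrite poly_def big_ord0 horner0 G0.
set p := \poly_(i < n.+1) c i.
(* Checked coefficientwise: the left side has coefficient [(i + 1)(i + d) p_(i+1)] at degree [i].
   The operator lowers degree by one, so truncation at [n.+1] turns into truncation at [n]. *)
have p_ode (y : R) : 0 <= y -> y * p^`()^`().[y] + d * p^`().[y] <= (\poly_(i < n) c i).[y].
  move=> y0; rewrite -subr_ge0.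
  have -> : (\poly_(i < n) c i).[y] - (y * p^`()^`().[y] + d * p^`().[y]) =
      (\poly_(i < n) c i - ('X * p^`()^`() + d *: p^`())).[y] by rewrite !hornerE.
  apply: horner_ge0 => // i; rewrite !coefD coefN coefD coefZ coefXM.
  have -> : (if i == 0 then 0 else p^`()^`()`_i.-1) = p`_i.+1 *+ i.+1 *+ i.
    by case: i => [|i]; rewrite ?mulr0n//= !coef_deriv.
  rewrite coef_deriv !coef_poly ltnS; case: ifP => _; last by rewrite !mul0rn mulr0 addr0 subr0.
  by rewrite -(mulr_natr _ i) -(mulr_natr _ i.+1); have := cS i; lra.
(* Subtracting [p_ode] from the inequality for [G] leaves at least [G] minus the previous partial
   sum, nonnegative by induction; the first-order result then applies to [G' - p']. *)
have p_le (y : R) : 0 <= y -> 0 <= G' y - p^`().[y].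
  apply: (@euler_operator_ge0 _ d (fun y => G' y - p^`().[y])
    (fun y => G'' y - p^`()^`().[y])) => // z z0.
    by have := dG' z z0; move=> ?; apply: is_deriveB.
  by have := p_ode z z0; have := ode z z0; have := IHn z z0; lra.
have := @le_at0_of_derive_ge0 _ (fun y => G y - p.[y]) (fun y => G' y - p^`().[y]) x.
rewrite horner_coef0 coef_poly /= => /(_ _ p_le x0) H.
rewrite -subr_ge0; apply: le_trans (H _); first by rewrite subr_ge0.
by move=> y y0; have := dG y y0; move=> ?; apply: is_deriveB.
Qed.

(** * Recurrence for the hypergeometric coefficients *)

Lemma hypergeom_coeff_ge0 (R : realType) (p q : nat)
    (a : 'I_p -> R) (b : 'I_q -> R) (n : nat) :
  (forall i, 0 < a i) -> (forall j, 0 < b j) -> 0 <= hypergeom_coeff a b n.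
Proof.
move=> a0 b0; rewrite divr_ge0 ?mulr_ge0 ?ler0n//;
  apply: prodr_ge0 => i _; apply: prodr_ge0 => k _; rewrite addr_ge0 ?ler0n//;
  exact: ltW.
Qed.

Lemma hypergeom_coeff0 (R : fieldType) (p q : nat) (a : 'I_p -> R) (b : 'I_q -> R) :
  hypergeom_coeff a b 0 = 1.
Proof.
rewrite /hypergeom_coeff /pochhammer fact0 mulr1.
by rewrite !big1 ?divr1// => i _; rewrite big_geq.
Qed.

Lemma hypergeom_coeffS (R : fieldType) (p q : nat)
    (a : 'I_p -> R) (b : 'I_q -> R) (n : nat) :
  hypergeom_coeff a b n.+1 = hypergeom_coeff a b n *
    ((\prod_(i < p) (a i + n%:R)) / ((\prod_(j < q) (b j + n%:R)) * n.+1%:R)).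
Proof.
have pochS m (v : 'I_m -> R) : \prod_(i < m) pochhammer (v i) n.+1 =
    (\prod_(i < m) pochhammer (v i) n) * \prod_(i < m) (v i + n%:R).
  by rewrite -big_split; apply: eq_bigr => i _; rewrite /pochhammer big_nat_recr.
rewrite /hypergeom_coeff !pochS factS natrM mulf_div; by congr (_ / _); ring.
Qed.

(** In the ratio of consecutive coefficients the factor [n.+1] cancels, leaving [prod_addr_le] at
    [x = n]. *)
Lemma hypergeom_coeffS_le (R : realType) (p : nat)
    (a : 'I_p -> R) (b : 'I_p.+1 -> R) (n : nat) :
  (forall i, 0 < a i) -> (forall j, 0 < b j) ->
  hypergeom_coeff a b n.+1 * (n.+1%:R * (n%:R + min_elem_sym_ratio a b)) <=
  hypergeom_coeff a b n.
Proof.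
move=> a0 b0; rewrite hypergeom_coeffS -mulrA ler_piMr ?hypergeom_coeff_ge0//.
have Pb0 : 0 < \prod_(j < p.+1) (b j + n%:R).
  by apply: prodr_gt0 => j _; rewrite ltr_wpDr ?ler0n.
rewrite mulrAC ler_pdivrMr ?mulr_gt0 ?ltr0n// mul1r mulrCA mulrC.
by rewrite ler_pM2r ?ltr0n// mulrC prod_addr_le ?ler0n.
Qed.

(** * The explicit supersolution *)

Section Majorant.
Variables (R : realType) (d : R).
Hypothesis d0 : 0 < d.

Let s (x : R) : R := Num.sqrt (4 * x + (d + 1) ^+ 2).

Let s_sqr (x : R) : 0 <= x -> s x ^+ 2 = 4 * x + (d + 1) ^+ 2.
Proof. by move=> x0; rewrite sqr_sqrtr// addr_ge0 ?sqr_ge0 ?mulr_ge0. Qed.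

(** Yields [d - 1 + s x >= 2 * d > 0], which keeps [v] and the base of the real power positive. *)
Let s_ge (x : R) : 0 <= x -> d + 1 <= s x.
Proof.
move=> x0; have d1 : 0 <= d + 1 by rewrite addr_ge0 ?ltW.
rewrite -[leLHS]ger0_norm// -sqrtr_sqr ler_sqrt ?lerDr ?mulr_ge0//.
by rewrite addr_ge0 ?sqr_ge0 ?mulr_ge0.
Qed.

Let s_neq0 (x : R) : 0 <= x -> s x != 0.
Proof. by move/s_ge => sge; rewrite gt_eqF//; move: d0; lra. Qed.

Let sD_neq0 (x : R) : 0 <= x -> d - 1 + s x != 0.
Proof. by move/s_ge => sge; rewrite gt_eqF//; move: d0; lra. Qed.

Let d_neq0 : d != 0.
Proof. by rewrite gt_eqF. Qed.

Let s_deriv (x : R) : 0 <= x -> is_derive x 1 s (2 / s x).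
Proof.
move=> x0.
have q0 : 0 < 4 * x + (d + 1) ^+ 2.
  by rewrite ltr_wpDl ?mulr_ge0// exprn_gt0// addr_gt0.
have dq : is_derive x (1 : R) (fun y : R => 4 * y + (d + 1) ^+ 2) 4.
  by apply: is_derive_eq; rewrite addr0 /GRing.scale/= mulr1.
have := @is_derive1_comp _ Num.sqrt (fun y : R => 4 * y + (d + 1) ^+ 2) x _ _
  (is_derive1_sqrt q0) dq.
move/is_derive_eq; apply; rewrite -/(s x).
by field; exact: s_neq0.
Qed.

Let v (x : R) : R := 2 / (d - 1 + s x).

Let v_deriv (x : R) : 0 <= x -> is_derive x 1 v (- (v x ^+ 2 / s x)).
Proof.
move=> x0; have ds := s_deriv x x0.
have dD : is_derive x (1 : R) (fun y : R => d - 1 + s y) (2 / s x).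
  by apply: is_derive_eq; ring.
have dV := @is_deriveV _ (fun y : R => d - 1 + s y) x _ _ (sD_neq0 x x0) dD.
have : is_derive x (1 : R) v (2 * (- (d - 1 + s x) ^- 2 *: (2 / s x))).
  exact: is_deriveZ.
move/is_derive_eq; apply.
by rewrite /v /GRing.scale/=; field; rewrite s_neq0 ?sD_neq0.
Qed.

(* [G' = v G], where [v] is the positive root of [(x + d) v^2 + (d - 1) v = 1]. *)
Definition bessel_majorant (x : R) : R :=
  expR (s x - d - 1) * ((d - 1) / (2 * d) + 1 / (2 * d) * s x) `^ (1 - d).

Let G := bessel_majorant.

Lemma bessel_majorant_ge0 (x : R) : 0 <= G x.
Proof. by rewrite mulr_ge0 ?expR_ge0 ?powR_ge0. Qed.

Lemma bessel_majorant0 : G 0 = 1.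
Proof.
have d1 : 0 <= d + 1 by move: d0; lra.
rewrite /G /bessel_majorant /s mulr0 add0r sqrtr_sqr ger0_norm//.
have -> : d + 1 - d - 1 = 0 by ring.
have -> : (d - 1) / (2 * d) + 1 / (2 * d) * (d + 1) = 1 by field.
by rewrite expR0 powR1 mulr1.
Qed.

(** The logarithmic derivative is [2/s + (1 - d)(2/s)/(d - 1 + s)], and this collapses to
    [2/(d - 1 + s) = v]. *)
Let G_deriv (x : R) : 0 <= x -> is_derive x 1 G (v x * G x).
Proof.
move=> x0; have sge := s_ge x x0; have ds := s_deriv x x0.
pose u (y : R) : R := (d - 1) / (2 * d) + 1 / (2 * d) * s y.
have uE : u x = (d - 1 + s x) / (2 * d) by rewrite /u; field.
have u0 : 0 < u x by rewrite uE divr_gt0; move: d0; lra.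
have du : is_derive x (1 : R) u (1 / (2 * d) * (2 / s x)).
  by apply: is_derive_eq; rewrite /GRing.scale/=; ring.
have dP := @is_derive1_comp _ (powR (R:=R) ^~ (1 - d)) u x _ _
  (is_derive1_powR (1 - d) u0) du.
have dL : is_derive x (1 : R) (fun y : R => s y - d - 1) (2 / s x).
  by apply: is_derive_eq; ring.
have dE := @is_derive1_comp _ expR (fun y : R => s y - d - 1) x _ _
  (is_derive_expR _) dL.
have := is_deriveM dE dP; move/is_derive_eq; apply.
(* Extracting one factor [u x] lets the remaining power be treated as an atom [w], so that a
   rational identity is left. *)
have uP : u x * u x `^ (1 - d - 1) = u x `^ (1 - d).
  rewrite -{1}(powRr1 (ltW u0)) -powRD ?subrKC//.
  by rewrite (gt_eqF u0) implybT.
rewrite /G /bessel_majorant -/(u x) /GRing.scale/= -uP.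
move: (u x `^ _) => w; rewrite /v uE.
by field; rewrite s_neq0 ?sD_neq0 ?d_neq0.
Qed.

Let G'_deriv (x : R) : 0 <= x ->
  is_derive x 1 (fun y => v y * G y) ((v x ^+ 2 - v x ^+ 2 / s x) * G x).
Proof.
move=> x0; have dG := G_deriv x x0; have dv := v_deriv x x0.
have := is_deriveM dv dG; move/is_derive_eq; apply.
by rewrite /GRing.scale/=; ring.
Qed.

(** It suffices that the factor multiplying [G x] is at least 1; its excess over 1 is exactly
    [((s - d - 1)/(d - 1 + s))^2 / s]. *)
Let G_ode (x : R) : 0 <= x ->
  G x <= x * ((v x ^+ 2 - v x ^+ 2 / s x) * G x) + d * (v x * G x).
Proof.
move=> x0; have sge := s_ge x x0; have s2 := s_sqr x x0.
rewrite (mulrA x) (mulrA d) -mulrDl; apply: ler_peMl; first exact: bessel_majorant_ge0.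
rewrite -subr_ge0.
(* Eliminating [x] through [s^2 = 4 x + (d + 1)^2] makes the excess a rational function of [s] and
   [d]. *)
rewrite [in X in X * _ + _](_ : x = (s x ^+ 2 - (d + 1) ^+ 2) / 4); last by rewrite s2; field.
have := s_neq0 x x0; have := sD_neq0 x x0; rewrite /v.
move: (s x) sge => t tge D0 t0.
set lhs := (X in 0 <= X).
have -> : lhs = ((t - d - 1) / (d - 1 + t)) ^+ 2 / t.
  by rewrite /lhs; field; rewrite t0 D0.
by rewrite divr_ge0 ?sqr_ge0//; move: d0; lra.
Qed.

Lemma poly_le_bessel_majorant (c : nat -> R) (n : nat) (x : R) :
  (forall n, c n.+1 * (n.+1%:R * (n%:R + d)) <= c n) -> c 0%N <= 1 ->
  0 <= x -> (\poly_(i < n) c i).[x] <= bessel_majorant x.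
Proof.
move=> cS c1.
apply: (@poly_le_supersolution _ _ d G _ _ _ _ d0 cS _ _ G_deriv G'_deriv G_ode).
  by rewrite bessel_majorant0.
by move=> y _; exact: bessel_majorant_ge0.
Qed.

End Majorant.

Arguments bessel_majorant {R} d x.

Theorem theorem11 (R : realType) (q : nat) (hq : (1 <= q)%N)
    (a : 'I_q.-1 -> R) (b : 'I_q -> R)
    (ha : forall i, 0 < a i) (hb : forall j, 0 < b j) :
  let d := min_elem_sym_ratio a b in
  0 < d ->
  forall x : R, 0 <= x ->
  hypergeom a b x <=
    expR (Num.sqrt (4 * x + (d + 1) ^+ 2) - d - 1) *
    ((d - 1) / (2 * d) + 1 / (2 * d) * Num.sqrt (4 * x + (d + 1) ^+ 2))
      `^ (1 - d).
Proof.
case: q hq a b ha hb => [//|p] _ a b ha hb d d0 x x0.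
have c_ge0 n : 0 <= hypergeom_coeff a b n by exact: hypergeom_coeff_ge0.
have partial_le n : pseries (hypergeom_coeff a b) x n <= bessel_majorant d x.
  rewrite /pseries /series/= big_mkord -horner_poly.
  apply: poly_le_bessel_majorant => //; last by rewrite hypergeom_coeff0.
  by move=> m; exact: hypergeom_coeffS_le.
(* Passing to the limit requires actual convergence: the terms are nonnegative, so the partial sums
   increase, and the majorant itself bounds them. *)
rewrite -/(bessel_majorant d x); apply: limr_le; last exact: nearW.
apply: nondecreasing_is_cvgn.
  by apply: nondecreasing_series => i _ _; rewrite mulr_ge0 ?exprn_ge0.
by exists (bessel_majorant d x) => _ [n _ <-].
Qed.
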